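(* Let $\Lambda^\bullet$ be a Gerstenhaber algebra admitting a BV operator $\Delta$ that generates its bracket, and assume $\Delta(1)=0$. Let $\partial:\Lambda^\bullet\to\Lambda^{\bullet+1}$ be a strong differential for the Gerstenhaber structure, i.e. $\partial^2=0$ and $\partial$ is a (super)derivation of both the product and the bracket. Then the degree zero map $$\partial\circ\Delta+\Delta\circ\partial:\Lambda^\bullet\to\Lambda^\bullet$$ is a derivation of $\Lambda^\bullet$ with respect to the product and with respect to the bracket.
   Context: A Gerstenhaber algebra is a ($\mathbb Z$-)graded-commutative associative unital algebra $\Lambda^\bullet$ with a bracket of degree $-1$ making the shift $\Lambda[1]$ a super Lie algebra (signs computed with degrees $|a|-1$) and satisfying $[a,bc]=[a,b]c+(-1)^{(|a|-1)|b|}b[a,c]$. A BV operator on a graded-commutative algebra is a linear operator $\Delta$ of degree $-1$ with $\Delta^2=0$ and $$\Delta(abc)-\Delta(ab)c+\Delta(a)bc-(-1)^{|a|}a\Delta(bc)-(-1)^{(|a|+1)|b|}b\Delta(ac)+(-1)^{|a|}a\Delta(b)c+(-1)^{|a|+|b|}ab\Delta(c)-\Delta(1)abc=0$$ for homogeneous $a,b,c$. When $\Delta(1)=0$, $\Delta$ generates the bracket if $[a,b]=(-1)^{|a|}\Delta(ab)-(-1)^{|a|}\Delta(a)b-a\Delta(b)$ for all homogeneous $a,b$. Strong differential: $\partial^2=0$, $\partial(ab)=\partial(a)b+(-1)^{|a|}a\,\partial(b)$ and $\partial[a,b]=[\partial a,b]+(-1)^{|a|-1}[a,\partial b]$ for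 homogeneous $a,b$. A degree zero derivation $D$ of the product (resp. bracket) satisfies $D(ab)=D(a)b+aD(b)$ (resp. $D[a,b]=[Da,b]+[a,Db]$). *)

(* Defs.v *)
From mathcomp Require Import all_boot all_order all_algebra.

Set Implicit Arguments.
Unset Strict Implicit.
Unset Printing Implicit Defensive.

Import GRing.Theory.
Local Open Scope ring_scope.

(* A Z-graded algebra is an algebra [A] together with the family [gr] of its
   homogeneous components: [gr n x] says that [x] lies in the component of
   degree [n] (so 0 lies in every component). *)

(* (-1)^n for an integer n: only the parity of n matters, so the power may be
   taken at the absolute value. *)
Definition ksign (K : comNzRingType) (n : int) : K := (-1) ^+ `|n|%N.

Section GradedAlgebras.
Context (K : comNzRingType) (A : algType K).
Implicit Types (gr : int -> A -> Prop) (br : {bilinear A -> A -> A}).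
Implicit Types (Delta d D : {linear A -> A}).

Local Notation sg := (ksign K).

Record graded_algebra gr : Prop := GradedAlgebra {
  graded0 : forall n, gr n 0;
  gradedP : forall n (c : K) x y, gr n x -> gr n y -> gr n (c *: x + y);
  graded_span : forall x, exists (s : seq int) (f : int -> A),
    (forall n, gr n (f n)) /\ x = \sum_(n <- s) f n;
  graded_direct : forall (s : seq int) (f : int -> A), uniq s ->
    (forall n, gr n (f n)) -> \sum_(n <- s) f n = 0 ->
    forall n, n \in s -> f n = 0;
  graded1 : gr 0 1;
  gradedM : forall i j a b, gr i a -> gr j b -> gr (i + j) (a * b)
}.

Definition graded_commutative gr : Prop :=
  forall i j a b, gr i a -> gr j b -> a * b = sg (i * j) *: (b * a).

Definition has_degree gr (k : int) D : Prop :=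
  forall n x, gr n x -> gr (n + k) (D x).

Record gerstenhaber_algebra gr br : Prop := GerstenhaberAlgebra {
  gerst_graded : graded_algebra gr;
  gerst_comm : graded_commutative gr;
  gerst_degree : forall i j a b, gr i a -> gr j b -> gr (i + j - 1) (br a b);
  gerst_antisym : forall i j a b, gr i a -> gr j b ->
    br a b = - (sg ((i - 1) * (j - 1)) *: br b a);
  gerst_jacobi : forall i j k a b c, gr i a -> gr j b -> gr k c ->
    br a (br b c) = br (br a b) c + sg ((i - 1) * (j - 1)) *: br b (br a c);
  gerst_leibniz : forall i j k a b c, gr i a -> gr j b -> gr k c ->
    br a (b * c) = br a b * c + sg ((i - 1) * j) *: (b * br a c)
}.

Record BV_operator gr Delta : Prop := BVOperator {
  BV_degree : has_degree gr (-1) Delta;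
  BV_square : forall x, Delta (Delta x) = 0;
  BV_identity : forall i j k a b c, gr i a -> gr j b -> gr k c ->
    Delta (a * b * c)
    - Delta (a * b) * c
    + Delta a * b * c
    - sg i *: (a * Delta (b * c))
    - sg ((i + 1) * j) *: (b * Delta (a * c))
    + sg i *: (a * Delta b * c)
    + sg (i + j) *: (a * b * Delta c)
    - Delta 1 * a * b * c = 0
}.

(* This notion is only meant for operators with [Delta 1 = 0]. *)
Definition generates_bracket gr br Delta : Prop :=
  forall i j a b, gr i a -> gr j b ->
    br a b = sg i *: Delta (a * b) - sg i *: (Delta a * b) - a * Delta b.

Record strong_differential gr br d : Prop := StrongDifferential {
  sdiff_degree : has_degree gr 1 d;
  sdiff_square : forall x, d (d x) = 0;
  sdiff_product : forall i j a b, gr i a -> gr j b ->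
    d (a * b) = d a * b + sg i *: (a * d b);
  sdiff_bracket : forall i j a b, gr i a -> gr j b ->
    d (br a b) = br (d a) b + sg (i - 1) *: br a (d b)
}.

Record product_derivation0 gr D : Prop := ProductDerivation0 {
  pder0_degree : has_degree gr 0 D;
  pder0_leibniz : forall a b, D (a * b) = D a * b + a * D b
}.

Record bracket_derivation0 gr br D : Prop := BracketDerivation0 {
  bder0_degree : has_degree gr 0 D;
  bder0_leibniz : forall a b, D (br a b) = br (D a) b + br a (D b)
}.

End GradedAlgebras.

(* Main.v *)
Require Import Defs.
From mathcomp Require Import all_boot all_order all_algebra.

(* Since Delta generates the bracket, Delta (a * b) is +-[a, b] plus the two
   Leibniz terms; d is a derivation of all of these, so in L (a * b), for
   L = d Delta + Delta d, the mixed terms cancel and L is a derivation of the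
   product.  As Delta^2 = 0, L commutes with Delta, hence L is a derivation of
   the bracket too, the bracket being an expression in Delta and the product. *)

Set Implicit Arguments.
Unset Strict Implicit.
Unset Printing Implicit Defensive.

Import GRing.Theory.
Local Open Scope ring_scope.

(** The exponent is an absolute value: adding 1 to [n] raises it by one for [n] nonnegative and
    lowers it by one for [n] negative, so its parity flips either way. *)
Lemma ksignD1 (K : comNzRingType) (n : int) : ksign K (n + 1) = - ksign K n.
Proof.
rewrite /ksign; case: n => n; first by rewrite -PoszD addn1 exprS mulN1r.
have -> : Negz n + 1 = - n%:Z by rewrite NegzE -addn1 PoszD opprD addrNK.
by rewrite NegzE !abszN exprS mulN1r opprK.
Qed.

Lemma ksignB1 (K : comNzRingType) (n : int) : ksign K (n - 1) = - ksign K n.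
Proof. by rewrite -{2}(subrK 1 n) ksignD1 opprK. Qed.

Lemma ksignK (K : comNzRingType) (V : lmodType K) (n : int) :
  involutive (fun v : V => ksign K n *: v).
Proof. by move=> v; rewrite scalerA -expr2 sqrr_sign scale1r. Qed.

Section GradedAlgebra.
Context (K : comNzRingType) (A : algType K) (gr : int -> A -> Prop).
Hypothesis grA : graded_algebra gr.

(** Reduces an identity additive in [x] to homogeneous [x], where the sign rules apply. *)
Lemma graded_ind (P : A -> Prop) :
  P 0 -> (forall x y, P x -> P y -> P (x + y)) ->
  (forall n x, gr n x -> P x) -> forall x, P x.
Proof.
move=> P0 PD Phom x; have [s [f [grf ->]]] := graded_span grA x.
by elim/big_ind: _ => // n _; apply: Phom (grf n).
Qed.

Lemma gradedD n x y : gr n x -> gr n y -> gr n (x + y).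
Proof. by rewrite -{2}(scale1r x); apply: (gradedP grA). Qed.

End GradedAlgebra.

Section BVLaplacian.
Context (K : comNzRingType) (A : algType K) (gr : int -> A -> Prop).
Context (br : {bilinear A -> A -> A}) (Delta d : {linear A -> A}).
Hypothesis grA : graded_algebra gr.
Hypothesis BV : BV_operator gr Delta.
Hypothesis gen : generates_bracket gr br Delta.
Hypothesis sd : strong_differential gr br d.

Local Notation sg := (ksign K).
Local Notation L := ((d \o Delta) \+ (Delta \o d)).

(** The generating formula solved for [Delta (a * b)], as [sg i] is its own inverse. *)
Lemma BV_mul i j a b : gr i a -> gr j b ->
  Delta (a * b) = sg i *: br a b + Delta a * b + sg i *: (a * Delta b).
Proof.
move=> ga gb; rewrite (gen ga gb) !scalerBr !ksignK.
by rewrite addrAC subrK subrK.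
Qed.

Lemma laplacian0 : L 0 = 0.
Proof. by rewrite /= !linear0 addr0. Qed.

Lemma laplacianD : {morph L : x y / x + y}.
Proof. by move=> x y; rewrite /= !linearD addrACA. Qed.

Lemma laplacianN : {morph L : x / - x}.
Proof. by move=> x; rewrite /= !linearN opprD. Qed.

Lemma laplacianZ c : {morph L : x / c *: x}.
Proof. by move=> x; rewrite /= !linearZ scalerDr. Qed.

Lemma laplacian_degree : has_degree gr 0 L.
Proof.
move=> n x gx; rewrite addr0 /=; apply: gradedD => //.
  by rewrite -[n](subrK 1); apply: (sdiff_degree sd); apply: (BV_degree BV).
by rewrite -[n](addrK 1); apply: (BV_degree BV); apply: (sdiff_degree sd).
Qed.

Lemma laplacian_mul (a b : A) : L (a * b) = L a * b + a * L b.
Proof.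
elim/(graded_ind grA): a => [|a1 a2 IH1 IH2|i a ga].
- by rewrite !(mul0r, laplacian0, addr0).
- by rewrite !(mulrDl a1) !laplacianD (mulrDl (L a1)) IH1 IH2 addrACA.
elim/(graded_ind grA): b => [|b1 b2 IH1 IH2|j b gb].
- by rewrite !(mulr0, laplacian0, addr0).
- by rewrite !(mulrDr _ b1) !laplacianD (mulrDr _ (L b1)) IH1 IH2 addrACA.
have gda := sdiff_degree sd ga; have gdb := sdiff_degree sd gb.
have gDa := BV_degree BV ga; have gDb := BV_degree BV gb.
rewrite /= (BV_mul ga gb) (sdiff_product sd ga gb) !linearD !linearZ /=.
rewrite (sdiff_bracket sd ga gb) (sdiff_product sd gDa gb).
rewrite (sdiff_product sd ga gDb) (BV_mul gda gb) (BV_mul ga gdb).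
(* [Delta a] and [d a] have degrees [i - 1] and [i + 1], so every sign becomes plus or minus [sg i],
   and its squares vanish. *)
rewrite ksignB1 ksignD1 !(scalerDr, scaleNr, scalerN) !ksignK mulrDl mulrDr.
set P := _ *: br (d a) b; set Q := br a (d b).
set X := _ *: (Delta a * d b); set Y := _ *: (d a * Delta b).
set M1 := d _ * b; set M2 := _ * b; set N1 := a * d _; set N2 := a * _.
(* This is [d (Delta (a * b))]; its mixed part [P + Y - Q - X] returns with the opposite sign in
   [Delta (d (a * b))], treated next. *)
have -> : P - Q + (M1 - X) + (Y + N1) = M1 + N1 + (P + Y - Q - X).
  by rewrite [LHS](AC (2*2*2) (3*6*(1*5*2*4))).
have -> : - P + M2 - Y + (Q + X + N2) = M2 + N2 - (P + Y - Q - X).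
  by rewrite !opprD !opprK [LHS](AC (3*3) (2*6*(1*3*4*5))).
by rewrite addrACA subrr addr0 addrACA.
Qed.

(** As [Delta] squares to zero, both sides reduce to [Delta (d (Delta x))]. *)
Lemma laplacian_comm x : L (Delta x) = Delta (L x).
Proof. by rewrite /= linearD !(BV_square BV) linear0 add0r addr0. Qed.

Lemma laplacian_bracket a b : L (br a b) = br (L a) b + br a (L b).
Proof.
elim/(graded_ind grA): a => [|a1 a2 IH1 IH2|i a ga].
- by rewrite !(linear0l, laplacian0, addr0).
- by rewrite linearDl !laplacianD linearDl [br (a1 + a2) _]linearDl IH1 IH2 addrACA.
elim/(graded_ind grA): b => [|b1 b2 IH1 IH2|j b gb].
- by rewrite !(linear0r, laplacian0, addr0).
- rewrite linearDr !laplacianD [br _ (b1 + b2)]linearDr linearDr.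
  by rewrite IH1 IH2 addrACA.
(* [L] preserves degrees, so all three brackets expand with the same sign [sg i]. *)
have gLa := laplacian_degree ga; rewrite addr0 in gLa.
have gLb := laplacian_degree gb; rewrite addr0 in gLb.
rewrite (gen ga gb) (gen gLa gb) (gen ga gLb).
rewrite !(laplacianD, laplacianN, laplacianZ) laplacian_comm.
rewrite !laplacian_mul !laplacian_comm.
rewrite (linearD Delta) !(scalerDr, opprD).
(* The odd terms contain [L a] and the even ones [L b]. *)
by rewrite [LHS](AC (2*2*2) ((1*3*5)*(2*4*6))).
Qed.

End BVLaplacian.

Theorem theorem2p4 (K : comNzRingType) (A : algType K)
  (gr : int -> A -> Prop) (br : {bilinear A -> A -> A})
  (Delta d : {linear A -> A}) :
  gerstenhaber_algebra gr br ->
  BV_operator gr Delta ->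
  Delta 1 = 0 ->
  generates_bracket gr br Delta ->
  strong_differential gr br d ->
  product_derivation0 gr ((d \o Delta) \+ (Delta \o d)) /\
  bracket_derivation0 gr br ((d \o Delta) \+ (Delta \o d)).
Proof.
move=> /gerst_graded grA BV _ gen sd.
split; split; try exact: laplacian_degree grA BV sd.
  exact: laplacian_mul grA BV gen sd.
exact: laplacian_bracket grA BV gen sd.
Qed.
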